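(* Let $\Gamma=(x_1,\dots,x_n)$ be an ordered point cloud in a metric space $(X,d)$ with sample radius $R_\Gamma$, and take chain complexes with coefficients in an arbitrary ring $\Lambda$. For every $r>R_\Gamma$, the map $\psi_r$ given by the formulas in the context is a well-defined degree-one chain map $$\psi_r\colon C_\bullet(\mathrm{DC}_r(\Gamma))\to C_{\bullet+1}(\check{\mathrm C}_r(\Gamma)).$$ The maps $\psi_r$ are compatible with the filtration inclusions, i.e. for $R_\Gamma<r\le s$ the maps $\psi_r$ and $\psi_s$ commute with the inclusions $C_\bullet(\mathrm{DC}_r(\Gamma))\hookrightarrow C_\bullet(\mathrm{DC}_s(\Gamma))$ and $C_{\bullet+1}(\check{\mathrm C}_r(\Gamma))\hookrightarrow C_{\bullet+1}(\check{\mathrm C}_s(\Gamma))$. Hence they define a degree-one morphism of $(R_\Gamma,\infty)$-filtered chain complexes $$\psi\colon C_\bullet(\mathrm{DC}(\Gamma))\to C_{\bullet+1}(\check{\mathrm C}(\Gamma)).$$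
   Context: $B(x,r)=\{y\in X\mid d(x,y)<r\}$ is the open ball. An ordered point cloud of length $n$ is a finite indexed family $\Gamma=(x_1,\dots,x_n)$ of (not necessarily distinct) points of $X$. Čech complex: $\check{\mathrm C}_r(\Gamma)$ is the simplicial complex whose simplices are the nonempty $\sigma\subset\{1,\dots,n\}$ with $\bigcap_{i\in\sigma}B(x_i,r)\neq\emptyset$. Its vertices are indices, so repeated points may give distinct vertices. Sample radius: $R_\Gamma=\inf\{r\ge 0\mid B(x_{i-1},r)\cap B(x_i,r)\neq\emptyset\text{ for all }2\le i\le n\}$. Elementary cubes in $\mathbb{R}^2$ are the products $I_1\times I_2$ with each $I_m$ either $[k,k]$ (also written $[k]$) or $[k,k+1]$, $k\in\mathbb{Z}$; the dimension is the number of factors of the form $[k,k+1]$. A cubical complex is a set of elementary cubes closed under faces (elementary cubes contained in a member). $C_k(K)$ is the free $\Lambda$-module on the $k$-dimensional cubes of $K$, with boundary $\partial([i]\times[j])=0$, $\partial([i]\times[j,j+1])=[i]\times[j+1]-[i]\times[j]$, $\partial([i,i+1]\times[j])=[i+1]\times[j]-[i]\times[j]$, $\partial([i,i+1]\times[j,j+1])=[i+1]\times[j,j+1]-[i]\times[j,j+1]-[i,i+1]\times[j+1]+[i,i+1]\times[j]$. Distance complex: $\mathrm{DC}_r(\Gamma)$ is the cubical complex of all elementary cubes $[i,j]\times[k,l]\subset[1,n]^2$ (so $j\in\{i,i+1\}$, $l\in\{k,k+1\}$) with $j\le k$ and $\{i,j,k,l\}\in\check{\mathrm C}_r(\Gamma)$.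 Both $\mathrm{DC}(\Gamma)=(\mathrm{DC}_r(\Gamma))_{r\ge0}$ and $\check{\mathrm C}(\Gamma)=(\check{\mathrm C}_r(\Gamma))_{r\ge0}$ are filtrations by inclusion. Simplicial chains are spanned by oriented simplices $[v_0,\dots,v_k]$ (alternating in the vertices; a symbol with a repeated vertex is zero). For $1\le i\le j\le n$ put $c_\Gamma(i,j)=\sum_{k=i+1}^{j}[k-1,k]$. The map $\psi_r$ (the distance-to-Čech map) is the linear extension of: for a vertex $v=(i,j)=[i]\times[j]$, $\psi_r(v)=c_\Gamma(i,j)-[i,j]$; for edges, $\psi_r([i,i+1]\times[j])=[i,j,i+1]$ and $\psi_r([i]\times[j,j+1])=[i,j,j+1]$; for squares, $\psi_r([i,i+1]\times[j,j+1])=[i,i+1,j,j+1]$. A degree-one chain map $C\to D$ is a family of homomorphisms $C_k\to D_{k+1}$ commuting with the boundary operators. A morphism of $I$-filtered objects is a family of maps indexed by $t\in I$ commuting with the inclusions. *)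

(* Defs.v *)
From HB Require Import structures.
From mathcomp Require Import all_boot all_order all_algebra.
From mathcomp Require Import ring_quotient zify.
From mathcomp Require Import mathcomp_extra boolp classical_sets functions.
From mathcomp Require Import cardinality fsbigop reals topology.

Set Implicit Arguments.
Unset Strict Implicit.
Unset Printing Implicit Defensive.

Import Order.TTheory GRing.Theory Num.Theory.

Local Open Scope classical_set_scope.
Local Open Scope ring_scope.

(* The base ring is an arbitrary (possibly zero, possibly noncommutative)
   unital ring and modules are left modules. *)

Section FreeModule.
Variables (A : pzRingType) (T : choiceType).

Definition finsupp (f : T -> A^o) : bool :=
  `[< finite_set [set t | f t != 0] >].

Lemma finsupp_submod : submod_closed finsupp.
Proof.
split=> [|a f g /asboolP ff /asboolP fg]; apply/asboolP.
  by apply: (sub_finite_set (B := set0)) => // t /=; rewrite eqxx.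
apply: (sub_finite_set (B := [set t | f t != 0] `|` [set t | g t != 0])).
  move=> t /=; rewrite !fctE => nz.
  have [f0|f0] := eqVneq (f t) 0; [right|by left].
  by apply: contraNneq nz => g0; rewrite f0 g0 scaler0 addr0.
by rewrite finite_setU.
Qed.

HB.instance Definition _ :=
  GRing.isSubmodClosed.Build A (T -> A^o) finsupp finsupp_submod.

Record freeMod := FreeMod {
  freeMod_val :> T -> A^o;
  freeMod_finsupp : freeMod_val \in finsupp }.

HB.instance Definition _ := [isSub for freeMod_val].
HB.instance Definition _ := [Choice of freeMod by <:].
HB.instance Definition _ := [SubChoice_isSubLmodule of freeMod by <:].

Lemma fgen_subproof (t : T) : (fun u => (u == t)%:R : A^o) \in finsupp.
Proof.
apply/asboolP; apply: (sub_finite_set (B := [set t])) => // u /=.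
by case: (eqVneq u t) => // _; rewrite eqxx.
Qed.

Definition fgen (t : T) : freeMod := FreeMod (fgen_subproof t).

Variable V : lmodType A.

(* Linear extension of g from the generators. *)
Definition flin_fun (g : T -> V) (u : freeMod) : V := \sum_(t \in setT) (u t : A) *: g t.

Lemma flin_finite (g : T -> V) (u : freeMod) (S : set T) :
  finite_set S -> [set t | u t != 0] `<=` S ->
  flin_fun g u = \sum_(t \in S) (u t : A) *: g t.
Proof.
move=> fS sS; apply/esym/fsbig_widen => // t [_ nSt] /=.
have [->|u0] := eqVneq (u t) 0; first by rewrite scale0r.
by case: nSt; apply: sS.
Qed.

Lemma flin_is_linear (g : T -> V) : linear (flin_fun g).
Proof.
move=> a u v.
have /asboolP fu := freeMod_finsupp u; have /asboolP fv := freeMod_finsupp v.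
set S := [set t | u t != 0] `|` [set t | v t != 0].
have fS : finite_set S by rewrite finite_setU.
rewrite (@flin_finite g (a *: u + v) S) //; last first.
  move=> t /=; rewrite !fctE => nz.
  have [u0|u0] := eqVneq (u t) 0; [right|by left].
  by apply: contraNneq nz => v0; rewrite u0 v0 scaler0 addr0.
rewrite (@flin_finite g u S) //; last by move=> t /= ?; left.
rewrite (@flin_finite g v S) //; last by move=> t /= ?; right.
rewrite !fsbig_finite //= scaler_sumr -big_split /=.
by apply: eq_bigr => t _; rewrite !fctE scalerDl scalerA.
Qed.

Definition flin (g : T -> V) := flin_fun g.
HB.instance Definition _ g :=
  GRing.isLinear.Build A freeMod V _ (flin g) (flin_is_linear g).

Lemma flin_gen g t : flin g (fgen t) = g t.
Proof.
rewrite /flin (@flin_finite _ _ [set t]) //.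
  by rewrite fsbig_set1 /= eqxx scale1r.
by move=> u /=; case: (eqVneq u t) => // _; rewrite eqxx.
Qed.

Lemma freeMod_ext (f g : {linear freeMod -> V}) :
  (forall t, f (fgen t) = g (fgen t)) -> f =1 g.
Proof.
move=> fg u; have /asboolP fu := freeMod_finsupp u.
have -> : u = \sum_(t <- finmap.enum_fset (fset_set [set t | u t != 0])) (u t : A) *: fgen t.
  apply/val_inj/funext => s; rewrite raddf_sum /= fct_sumE.
  under eq_bigr do rewrite !fctE /=.
  have [us|us] := eqVneq (u s) 0.
    rewrite us big1_seq // => t /=.
    rewrite in_fset_set // inE /= => ut.
    case: eqVneq => [st|_]; last by rewrite scaler0.
    by move: ut; rewrite -st us eqxx.
  rewrite (bigD1_seq s) ?finmap.fset_uniq //=; last first.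
    by rewrite in_fset_set // inE.
  rewrite eqxx /GRing.scale /= mulr1 big1 ?addr0 // => t ts.
  by rewrite eq_sym (negbTE ts) mulr0.
by rewrite !raddf_sum /=; apply: eq_bigr => t _; rewrite !linearZ /= fg.
Qed.

End FreeModule.

Section QuotientModule.
Variables (A : pzRingType) (V : lmodType A) (G : set V).

Inductive in_span : V -> Prop :=
| in_span0 : in_span 0
| in_spanD a g v : G g -> in_span v -> in_span (a *: g + v).

Definition span (v : V) : bool := `[< in_span v >].

Lemma span_submod : submod_closed span.
Proof.
split=> [|a u v /asboolP su /asboolP sv]; apply/asboolP.
  exact: in_span0.
elim: su => [|b g w Gg _ IH]; first by rewrite scaler0 add0r.
by rewrite scalerDr scalerA -addrA; apply: in_spanD.
Qed.

HB.instance Definition _ := GRing.isSubmodClosed.Build A V span span_submod.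

Definition span_zmod : zmodClosed V := GRing.ZmodClosed.clone V span _.

Definition quotMod := Quotient.quot span_zmod.
HB.instance Definition _ := Choice.on quotMod.
HB.instance Definition _ := GRing.Zmodule.on quotMod.

Local Notation pi := (\pi_(Quotient.quot span_zmod))%qT.

Lemma quot_pi_eq (u v : V) : (pi u == pi v) = (u - v \in span).
Proof. by rewrite -Quotient.idealrBE. Qed.

Definition quot_scale (a : A) (q : quotMod) : quotMod :=
  pi (a *: generic_quotient.repr (q : Quotient.quot span_zmod)).

Lemma quot_scale_pi a u : quot_scale a (pi u) = pi (a *: u).
Proof.
apply/eqP; rewrite quot_pi_eq -scalerBr rpredZ // -quot_pi_eq.
by rewrite generic_quotient.reprK.
Qed.

Lemma pi_surj (q : quotMod) : exists u, q = pi u.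
Proof. by exists (generic_quotient.repr (q : Quotient.quot span_zmod)); rewrite generic_quotient.reprK. Qed.

Fact quot_scaleA a b q : quot_scale a (quot_scale b q) = quot_scale (a * b) q.
Proof. by have [u ->] := pi_surj q; rewrite !quot_scale_pi scalerA. Qed.
Fact quot_scale1 : left_id 1 quot_scale.
Proof. by move=> q; have [u ->] := pi_surj q; rewrite !quot_scale_pi scale1r. Qed.
Fact quot_scaleDr : right_distributive quot_scale +%R.
Proof.
move=> a p q; have [u ->] := pi_surj p; have [v ->] := pi_surj q.
by rewrite !quot_scale_pi -!raddfD /= quot_scale_pi scalerDr.
Qed.
Fact quot_scaleDl q : {morph quot_scale^~ q : a b / a + b}.
Proof.
move=> a b; have [u ->] := pi_surj q.
by rewrite !quot_scale_pi scalerDl raddfD.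
Qed.

HB.instance Definition _ := GRing.Zmodule_isLmodule.Build A quotMod
  quot_scaleA quot_scale1 quot_scaleDr quot_scaleDl.

Definition qclass (u : V) : quotMod := pi u.

Lemma qclass_is_linear : linear qclass.
Proof. by move=> a u v; rewrite /qclass raddfD /= -quot_scale_pi. Qed.
HB.instance Definition _ :=
  GRing.isLinear.Build A V quotMod _ qclass qclass_is_linear.

Lemma qclass_surj (q : quotMod) : exists u, q = qclass u.
Proof. exact: pi_surj. Qed.

Lemma qclass_rel u : G u -> qclass u = 0.
Proof.
move=> Gu; rewrite -[RHS](linear0 qclass); apply/eqP.
rewrite /qclass quot_pi_eq subr0; apply/asboolP.
by rewrite -[u]addr0 -[u]scale1r; apply: in_spanD => //; apply: in_span0.
Qed.

Section Lift.
Variables (W : lmodType A) (f : {linear V -> W}).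

Definition qlift of (forall g, G g -> f g = 0) := fun q : quotMod =>
  f (generic_quotient.repr (q : Quotient.quot span_zmod)).

Hypothesis f0 : forall g, G g -> f g = 0.

Lemma span_ker u : u \in span -> f u = 0.
Proof.
move=> /asboolP; elim=> [|a g v Gg _ IH]; first exact: linear0.
by rewrite linearP f0 // IH scaler0 addr0.
Qed.

Lemma qlift_class u : qlift f0 (qclass u) = f u.
Proof.
apply/eqP; rewrite -subr_eq0 -linearB; apply/eqP/span_ker.
by rewrite -quot_pi_eq generic_quotient.reprK.
Qed.

Lemma qlift_is_linear : linear (qlift f0).
Proof.
move=> a p q; have [u ->] := qclass_surj p; have [v ->] := qclass_surj q.
by rewrite -linearP !qlift_class linearP.
Qed.
End Lift.

End QuotientModule.

HB.instance Definition _ (A : pzRingType) (V : lmodType A) (G : set V)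
    (W : lmodType A) (f : {linear V -> W}) (f0 : forall g, G g -> f g = 0) :=
  GRing.isLinear.Build A (@quotMod A V G) W _ (@qlift A V G W f f0)
    (@qlift_is_linear A V G W f f0).

Lemma quotMod_ext (A : pzRingType) (V W : lmodType A) (G : set V)
    (f g : {linear quotMod G -> W}) :
  (forall v, f (qclass G v) = g (qclass G v)) -> f =1 g.
Proof. by move=> fg q; have [v ->] := qclass_surj q. Qed.

Record chain_complex (A : pzRingType) := ChainComplex {
  cc_mod :> int -> lmodType A;
  cc_d : forall k, {linear cc_mod (k + 1) -> cc_mod k};
  cc_dd : forall k c, cc_d k (cc_d (k + 1) c) = 0 }.

Record chain_map (A : pzRingType) (C D : chain_complex A) := ChainMap {
  cm_fun :> forall k, {linear C k -> D k};
  cm_comm : forall k c, cc_d D k (cm_fun (k + 1) c) = cm_fun k (cc_d C k c) }.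

(* No sign: a degree-one chain map commutes with the boundary operators.
   For k = -1 the equation says that elements of C 0 are sent to cycles as
   soon as C (-1) = 0, which is the case below. *)
Definition is_chain_map1 (A : pzRingType) (C D : chain_complex A)
    (f : forall k, {linear C k -> D (k + 1)}) :=
  forall k c, cc_d D (k + 1) (f (k + 1) c) = f k (cc_d C k c).

Record chain_map1 (A : pzRingType) (C D : chain_complex A) := ChainMap1 {
  cm1_fun :> forall k, {linear C k -> D (k + 1)};
  cm1_comm : is_chain_map1 cm1_fun }.

(* A functor from I, ordered as a subset of R, to chain complexes. *)
Record filtered_complex (A : pzRingType) (R : realType) (I : set R) :=
  FilteredComplex {
  fc_obj :> I -> chain_complex A;
  fc_incl : forall s t : I, val s <= val t -> chain_map (fc_obj s) (fc_obj t);
  fc_incl_id : forall (s : I) (ss : val s <= val s) k c,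
    fc_incl ss k c = c;
  fc_incl_comp : forall (s t u : I) (st : val s <= val t) (tu : val t <= val u)
    (su : val s <= val u) k c,
    fc_incl tu k (fc_incl st k c) = fc_incl su k c }.

Record filtered_map1 (A : pzRingType) (R : realType) (I : set R)
    (C D : filtered_complex A I) := FilteredMap1 {
  fm1_fun :> forall t : I, chain_map1 (C t) (D t);
  fm1_comm : forall (s t : I) (st : val s <= val t) k c,
    fc_incl D st (k + 1) (fm1_fun s k c) = fm1_fun t k (fc_incl C st k c) }.

(* (k, false) is the degenerate interval [k, k], (k, true) is [k, k + 1]. *)
Definition eint := (int * bool)%type.
Definition ecube := (eint * eint)%type.

Definition pt (k : int) : eint := (k, false).
Definition seg (k : int) : eint := (k, true).
Definition lo (I : eint) : int := I.1.
Definition hi (I : eint) : int := I.1 + (I.2 : nat)%:Z.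

Definition cdim (c : ecube) : nat := (c.1.2 + c.2.2)%N.

Definition eint_sub (I J : eint) := (lo J <= lo I) && (hi I <= hi J).
Definition cface (e c : ecube) := eint_sub e.1 c.1 && eint_sub e.2 c.2.

Record cubical_complex := CubicalComplex {
  cubes :> ecube -> Prop;
  cubes_face : forall c e, cubes c -> cface e c -> cubes e }.

Lemma square_cancel (V : zmodType) (p q r t : V) :
  p - q - (r - t) - (p - r) + (q - t) = 0.
Proof.
rewrite !opprB -addrA addrACA (addrC (p - q)) (addrC (t - r)).
by rewrite !addrA !subrK subrr.
Qed.

Section CubicalChains.
Variables (A : pzRingType) (K : cubical_complex).
Implicit Types (k : int) (c : ecube).

Definition kcube k : Type := {c : ecube | `[< K c >] && ((cdim c)%:Z == k)}.

HB.instance Definition _ k := Choice.on (kcube k).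
HB.instance Definition _ k := SubType.on (kcube k).

Definition cchain k := freeMod A (kcube k).

(* The generator of a k-cube of K; by convention 0 for any other cube. *)
Definition cgen k c : cchain k :=
  if insub c is Some o then fgen A o else 0.

Definition cbnd k c : cchain k :=
  match c with
  | ((i, false), (j, false)) => 0
  | ((i, false), (j, true)) => cgen k (pt i, pt (j + 1)) - cgen k (pt i, pt j)
  | ((i, true), (j, false)) => cgen k (pt (i + 1), pt j) - cgen k (pt i, pt j)
  | ((i, true), (j, true)) =>
      cgen k (pt (i + 1), seg j) - cgen k (pt i, seg j)
      - cgen k (seg i, pt (j + 1)) + cgen k (seg i, pt j)
  end.

Definition cboundary k : cchain (k + 1) -> cchain k :=
  flin (fun o : kcube (k + 1) => cbnd k (val o)).
Arguments cboundary : clear implicits.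
HB.instance Definition _ k := GRing.Linear.on (cboundary k).

Lemma cgenE k (o : kcube k) : cgen k (val o) = fgen A o.
Proof. by rewrite /cgen valK. Qed.

Lemma cboundary_gen k c : K c -> (cdim c)%:Z = k + 1 ->
  cboundary k (cgen (k + 1) c) = cbnd k c.
Proof.
move=> Kc /eqP dc; rewrite /cgen insubT; first by apply/andP; split => //; apply/asboolP.
by move=> h; exact: flin_gen.
Qed.

Lemma cboundary_boundary k (z : cchain (k + 1 + 1)) :
  cboundary k (cboundary (k + 1) z) = 0.
Proof.
suff : (cboundary k \o cboundary (k + 1)) =1 (\0 : _ -> _) by apply.
apply: freeMod_ext => o /=; rewrite [X in cboundary k X]flin_gen.
case: o => -[[i b] [j b']] /= /andP[/asboolP Kc /eqP dc].
have Kf e : cface e (i, b, (j, b')) -> K e by exact: cubes_face.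
have bd e : cface e (i, b, (j, b')) -> (cdim e)%:Z = k + 1 ->
  cboundary k (cgen (k + 1) e) = cbnd k e by move=> /Kf; exact: cboundary_gen.
move: dc bd; rewrite /cdim {Kc Kf}; case: b b' => -[] /= dc bd.
- rewrite linearD !linearB /= !bd ?/cdim /= /cface /eint_sub /lo /hi /=; try lia.
  exact: square_cancel.
- rewrite linearB /= !bd ?/cdim /= /cface /eint_sub /lo /hi /=; try lia.
  by rewrite subrr.
- rewrite linearB /= !bd ?/cdim /= /cface /eint_sub /lo /hi /=; try lia.
  by rewrite subrr.
by rewrite linear0.
Qed.

End CubicalChains.

Arguments cboundary : clear implicits.

Definition cub_complex (A : pzRingType) (K : cubical_complex) : chain_complex A :=
  @ChainComplex A (fun k => cchain A K k : lmodType A)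
    (fun k => cboundary A K k : {linear _ -> _}) (@cboundary_boundary A K).

Section CubicalInclusion.
Variables (A : pzRingType) (K L : cubical_complex).
Hypothesis KL : cubes K `<=` cubes L.

Definition cub_incl_fun k : cchain A K k -> cchain A L k :=
  flin (fun o : kcube K k => cgen A L k (val o)).
Arguments cub_incl_fun : clear implicits.
HB.instance Definition _ k := GRing.Linear.on (cub_incl_fun k).

Lemma cub_incl_gen k c : K c -> cub_incl_fun k (cgen A K k c) = cgen A L k c.
Proof.
move=> Kc; rewrite {1}/cgen; case: insubP => [o _ <-|]; first exact: flin_gen.
have -> : `[< K c >] by apply/asboolP.
move=> /= /negbTE dc; rewrite linear0 /cgen insubF //.
by rewrite dc andbF.
Qed.

Lemma cub_incl_bnd k c : K c -> cub_incl_fun k (cbnd A K k c) = cbnd A L k c.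
Proof.
case: c => -[i b] [j b'] Kc.
have cu e : cface e (i, b, (j, b')) -> cub_incl_fun k (cgen A K k e) = cgen A L k e.
  by move=> ef; apply: cub_incl_gen; apply: cubes_face Kc ef.
case: b b' Kc cu => -[] /= Kc cu; last by rewrite linear0.
- rewrite linearD !linearB /= !cu // /cface /eint_sub /lo /hi /=; lia.
- rewrite linearB /= !cu // /cface /eint_sub /lo /hi /=; lia.
- rewrite linearB /= !cu // /cface /eint_sub /lo /hi /=; lia.
Qed.

Lemma cub_incl_comm k z :
  cboundary A L k (cub_incl_fun (k + 1) z) = cub_incl_fun k (cboundary A K k z).
Proof.
suff : cboundary A L k \o cub_incl_fun (k + 1) =1
  cub_incl_fun k \o cboundary A K k by apply.
apply: freeMod_ext => o /=.
rewrite [X in cub_incl_fun k X]flin_gen [X in cboundary _ _ _ X]flin_gen.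
have /andP[/asboolP Ko /eqP dc] := valP o.
by rewrite cub_incl_bnd // cboundary_gen //; apply: KL.
Qed.

Definition cub_incl : chain_map (cub_complex A K) (cub_complex A L) :=
  @ChainMap A (cub_complex A K) (cub_complex A L)
    (fun k => cub_incl_fun k : {linear _ -> _}) cub_incl_comm.

End CubicalInclusion.

Record simplicial_complex (V : finType) := SimplicialComplex {
  simplices :> {set V} -> Prop;
  simplices_neq0 : forall S, simplices S -> (0 < #|S|)%N;
  simplices_sub : forall S S' : {set V},
    simplices S -> S' \subset S -> (0 < #|S'|)%N -> simplices S' }.

Section FaceSum.
Variables (A : pzRingType) (T : eqType) (M : lmodType A).
Implicit Types (f : seq T -> M) (s : seq T).

(* \sum_i (-1)^i f(v_0, .., v_i omitted, .., v_k) *)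
Definition face_sum f s : M :=
  \sum_(i < size s) (-1) ^+ i *: f (take i s ++ drop i.+1 s).

Lemma face_sum_nil f : face_sum f [::] = 0.
Proof. by rewrite /face_sum big_ord0. Qed.

Lemma face_sum_cons f x s :
  face_sum f (x :: s) = f s - face_sum (fun t => f (x :: t)) s.
Proof.
rewrite /face_sum /= big_ord_recl /= expr0 scale1r drop0; congr (_ + _).
rewrite -sumrN; apply: eq_bigr => i _ /=.
by rewrite /bump /= add1n exprS mulN1r scaleNr.
Qed.

Lemma face_sum_face_sum f s : face_sum (face_sum f) s = 0.
Proof.
elim: s f => [|x s IH] f; first exact: face_sum_nil.
rewrite face_sum_cons.
have -> : face_sum (fun t => face_sum f (x :: t)) s =
    face_sum f s - face_sum (face_sum (fun t => f (x :: t))) s.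
  rewrite /face_sum -sumrB; apply: eq_bigr => i _.
  by rewrite -scalerBr -face_sum_cons.
by rewrite IH subr0 subrr.
Qed.

Definition alternating f :=
  (forall a x b y c, f (a ++ x :: b ++ y :: c) + f (a ++ y :: b ++ x :: c) = 0) /\
  (forall s, ~~ uniq s -> f s = 0).

Definition adj_alternating f :=
  (forall a x y c, f (a ++ x :: y :: c) + f (a ++ y :: x :: c) = 0) /\
  (forall a x c, f (a ++ x :: x :: c) = 0).

Lemma alternating_adj f : alternating f -> adj_alternating f.
Proof.
move=> [f2 f0]; split=> [a x y c|a x c]; first exact: (f2 a x [::] y c).
by apply: f0; rewrite cat_uniq /= inE eqxx /= !andbF.
Qed.

Lemma adj_alternatingW f : adj_alternating f -> alternating f.
Proof.
move=> [f2 f0].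
have fN a x y c : f (a ++ x :: y :: c) = - f (a ++ y :: x :: c).
  by apply/eqP; rewrite -addr_eq0 f2.
split=> [a x b y c|s].
  elim: b a => [|z b IH] a /=; first exact: f2.
  rewrite fN (fN a y) -opprD; apply/eqP; rewrite oppr_eq0; apply/eqP.
  rewrite -!(cat_rcons z a); have := IH (rcons a z).
  by [].
have rep x b : forall a c, f (a ++ x :: b ++ x :: c) = 0.
  elim: b => [|z b IH] a c /=; first exact: f0.
  by rewrite fN -cat_rcons IH oppr0.
move=> ns; have [a [x [b [c ->]]]] : exists a x b c, s = a ++ x :: b ++ x :: c.
  elim: s ns => //= x s IH; rewrite negb_and negbK => /orP[/splitPr[b c]|].
    by exists [::], x, b, c.
  by move=> /IH[a [y [b [c ->]]]]; exists (x :: a), y, b, c.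
exact: rep.
Qed.

Lemma adj_alternating_face_sum f : adj_alternating f -> adj_alternating (face_sum f).
Proof.
have F0 g s : (forall t, g t = 0) -> face_sum g s = 0.
  by move=> g0; rewrite /face_sum big1 // => i _; rewrite g0 scaler0.
move=> [f2 f0]; split=> a; elim: a f f2 f0 => [|z a IH] f f2 f0.
- move=> x y c /=; rewrite !face_sum_cons !opprB.
  rewrite [X in X + _]addrCA [X in _ + X]addrCA addrACA.
  rewrite [X in _ + X = _]addrA subrK subrr addr0.
  rewrite /face_sum -big_split big1 // => i _ /=.
  by rewrite -scalerDr (f2 [::]) scaler0.
- move=> x y c /=; rewrite !face_sum_cons addrACA -opprD f2 add0r.
  by rewrite IH ?oppr0 // => *; [exact: (f2 (_ :: _))|exact: (f0 (_ :: _))].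
- move=> x c /=; rewrite !face_sum_cons opprB addrCA subrr addr0.
  by apply: F0 => t; exact: (f0 [::]).
- move=> x c /=; rewrite face_sum_cons f0 sub0r.
  by rewrite IH ?oppr0 // => *; [exact: (f2 (_ :: _))|exact: (f0 (_ :: _))].
Qed.

Lemma alternating_face_sum f : alternating f -> alternating (face_sum f).
Proof.
by move=> /alternating_adj/adj_alternating_face_sum/adj_alternatingW.
Qed.

End FaceSum.

Lemma linear_face_sum (A : pzRingType) (T : eqType) (M N : lmodType A)
    (h : {linear M -> N}) (f : seq T -> M) s :
  h (face_sum f s) = face_sum (h \o f) s.
Proof. by rewrite /face_sum linear_sum; apply: eq_bigr => i _; rewrite linearZ. Qed.

Lemma eq_face_sum (A : pzRingType) (T : eqType) (M : lmodType A)
    (f g : seq T -> M) s :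
  (forall i, (i < size s)%N ->
     f (take i s ++ drop i.+1 s) = g (take i s ++ drop i.+1 s)) ->
  face_sum f s = face_sum g s.
Proof. by move=> fg; apply: eq_bigr => i _; rewrite fg. Qed.

Section SimplicialChains.
Variables (A : pzRingType) (V : finType) (K : simplicial_complex V).
Implicit Types (k : int) (s : seq V).

(* Symbols [v_0, .., v_k], possibly with repetitions, whose vertices span a
   simplex of K. *)
Definition ksymb k : Type :=
  {s : seq V | `[< K [set:: s] >] && ((size s)%:Z == k + 1)}.
HB.instance Definition _ k := Choice.on (ksymb k).
HB.instance Definition _ k := SubType.on (ksymb k).

(* By convention 0 for any other sequence of vertices. *)
Definition fsymb k s : freeMod A (ksymb k) :=
  if insub s is Some o then fgen A o else 0.

Inductive orient_rel k : freeMod A (ksymb k) -> Prop :=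
| orient_swap a x b y c :
    orient_rel (fsymb k (a ++ x :: b ++ y :: c) + fsymb k (a ++ y :: b ++ x :: c))
| orient_repeat s : ~~ uniq s -> orient_rel (fsymb k s).

Definition schain k := quotMod (@orient_rel k).

(* The oriented simplex [v_0, .., v_k] of K. *)
Definition osimplex k s : schain k := qclass _ (fsymb k s).

Lemma osimplex_alternating k : alternating (osimplex k).
Proof.
split=> [a x b y c|s ns].
  by rewrite /osimplex -linearD; apply: qclass_rel; apply: orient_swap.
by apply: qclass_rel; apply: orient_repeat.
Qed.

Lemma set_seq_swap a x b y c :
  [set:: a ++ x :: b ++ y :: c] = [set:: a ++ y :: b ++ x :: c] :> {set V}.
Proof.
apply/setP => v; rewrite !inE !mem_cat !inE !mem_cat !inE.
by case: (v \in a); case: (v \in b); case: (v \in c);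
  case: (v == x); case: (v == y).
Qed.

Section Extension.
Variables (W : lmodType A) (k : int) (f : seq V -> W).
Hypothesis f_alt : alternating f.

Lemma orient_rel_flin g :
  orient_rel g -> flin (fun o : ksymb k => f (val o)) g = 0.
Proof.
have fE s : flin (fun o : ksymb k => f (val o)) (fsymb k s) =
    if `[< K [set:: s] >] && ((size s)%:Z == k + 1) then f s else 0.
  rewrite /fsymb; case: insubP => [o -> <-|/negbTE ->]; first exact: flin_gen.
  exact: linear0.
case=> [a x b y c|s ns]; last by rewrite fE f_alt.2 // if_same.
rewrite linearD /= !fE set_seq_swap.
have -> : size (a ++ x :: b ++ y :: c) = size (a ++ y :: b ++ x :: c).
  by rewrite !size_cat /= !size_cat.
by case: ifP => _; [exact: f_alt.1|rewrite addr0].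
Qed.

Definition slin : schain k -> W := qlift orient_rel_flin.
HB.instance Definition _ := GRing.Linear.on slin.

Lemma slin_osimplex s : K [set:: s] -> (size s)%:Z = k + 1 ->
  slin (osimplex k s) = f s.
Proof.
move=> Ks /eqP ss; rewrite /slin [LHS]qlift_class /fsymb insubT.
  by apply/andP; split => //; apply/asboolP.
by move=> ?; exact: flin_gen.
Qed.

End Extension.

Arguments slin [W] k [f] f_alt _.

Lemma osimplex_out k s :
  ~ (K [set:: s] /\ (size s)%:Z = k + 1) -> osimplex k s = 0.
Proof.
move=> nKs; rewrite /osimplex /fsymb insubF ?linear0 //.
by apply/negP => /andP[/asboolP ? /eqP ?]; apply: nKs.
Qed.

Lemma schain_ext (W : lmodType A) k (f g : {linear schain k -> W}) :
  (forall s, K [set:: s] -> (size s)%:Z = k + 1 ->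
     f (osimplex k s) = g (osimplex k s)) -> f =1 g.
Proof.
move=> fg; apply: quotMod_ext => v.
suff : f \o qclass _ =1 g \o qclass _ by apply.
apply: freeMod_ext => o /=; have /andP[/asboolP Ko /eqP so] := valP o.
by have := fg _ Ko so; rewrite /osimplex /fsymb valK.
Qed.

Definition sboundary k : schain (k + 1) -> schain k :=
  slin (k + 1) (alternating_face_sum (osimplex_alternating k)).
Arguments sboundary : clear implicits.
HB.instance Definition _ k := GRing.Linear.on (sboundary k).

Lemma sboundary_osimplex k s : K [set:: s] -> (size s)%:Z = k + 1 + 1 ->
  sboundary k (osimplex (k + 1) s) = face_sum (osimplex k) s.
Proof. exact: slin_osimplex. Qed.

Lemma osimplex_nil k : osimplex k [::] = 0.
Proof.
apply: osimplex_out => -[/simplices_neq0]; rewrite card_gt0 => /set0Pn[v].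
by rewrite inE.
Qed.

Lemma sub_simplex s (t : seq V) : K [set:: s] -> {subset t <= s} -> t != [::] -> K [set:: t].
Proof.
move=> Ks ts tn; apply: simplices_sub Ks _ _.
  by apply/fintype.subsetP => v; rewrite !inE; apply: ts.
case: t ts tn => // v t _ _; rewrite card_gt0; apply/set0Pn; exists v.
by rewrite !inE eqxx.
Qed.

Lemma mem_face s i : {subset take i s ++ drop i.+1 s <= s}.
Proof. by move=> v; rewrite mem_cat => /orP[/mem_take|/mem_drop]. Qed.

Lemma size_face s i : (i < size s)%N -> size (take i s ++ drop i.+1 s) = (size s).-1.
Proof. by move=> si; rewrite size_cat size_take size_drop si; lia. Qed.

Lemma sboundary_boundary k (z : schain (k + 1 + 1)) :
  sboundary k (sboundary (k + 1) z) = 0.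
Proof.
suff : sboundary k \o sboundary (k + 1) =1 (\0 : _ -> _) by apply.
apply: schain_ext => s Ks ss /=.
rewrite sboundary_osimplex // linear_face_sum -[RHS](face_sum_face_sum (osimplex k) s).
apply: eq_face_sum => i si /=.
have [fs|fs] := eqVneq (take i s ++ drop i.+1 s) [::].
  by rewrite fs osimplex_nil linear0 face_sum_nil.
rewrite sboundary_osimplex //; first exact: sub_simplex Ks (@mem_face _ _) fs.
by rewrite size_face //; move: ss si; case: (size s) => [|m] /=; lia.
Qed.

End SimplicialChains.

Arguments slin [A V] K [W] k [f] f_alt _.
Arguments sboundary : clear implicits.

Definition simp_complex (A : pzRingType) (V : finType) (K : simplicial_complex V) :
    chain_complex A :=
  @ChainComplex A (fun k => schain A K k : lmodType A)
    (fun k => sboundary A V K k : {linear _ -> _}) (@sboundary_boundary A V K).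

Section SimplicialInclusion.
Variables (A : pzRingType) (V : finType) (K L : simplicial_complex V).
Hypothesis KL : simplices K `<=` simplices L.

Definition simp_incl_fun k : schain A K k -> schain A L k :=
  slin K k (osimplex_alternating A L k).
Arguments simp_incl_fun : clear implicits.
HB.instance Definition _ k := GRing.Linear.on (simp_incl_fun k).

Lemma simp_incl_osimplex k s : K [set:: s] ->
  simp_incl_fun k (osimplex A K k s) = osimplex A L k s.
Proof.
move=> Ks; have [ss|ss] := eqVneq (size s)%:Z (k + 1); first exact: slin_osimplex.
by rewrite !osimplex_out ?linear0 // => -[_ /eqP]; rewrite (negbTE ss).
Qed.

Lemma simp_incl_comm k z :
  sboundary A V L k (simp_incl_fun (k + 1) z) = simp_incl_fun k (sboundary A V K k z).
Proof.
suff : sboundary A V L k \o simp_incl_fun (k + 1) =1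
  simp_incl_fun k \o sboundary A V K k by apply.
apply: schain_ext => s Ks ss /=.
rewrite simp_incl_osimplex // !sboundary_osimplex //; last exact: KL.
rewrite linear_face_sum; apply: eq_face_sum => i si /=.
have [->|fs] := eqVneq (take i s ++ drop i.+1 s) [::].
  by rewrite !osimplex_nil linear0.
by rewrite simp_incl_osimplex //; exact: sub_simplex Ks (@mem_face _ _ _) fs.
Qed.

Definition simp_incl : chain_map (simp_complex A K) (simp_complex A L) :=
  @ChainMap A (simp_complex A K) (simp_complex A L)
    (fun k => simp_incl_fun k : {linear _ -> _}) simp_incl_comm.

End SimplicialInclusion.

(* The point x_m (1 <= m <= n) of the cloud is x i with i : 'I_n of value
   m - 1; accordingly the cubes of the distance complex are subsets of
   [0, n - 1]^2 rather than [1, n]^2.  In a metricType, ball y r is the open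
   ball [set z | mdist y z < r], see ballEmdist. *)

Section PointCloud.
Variables (R : realType) (X : metricType R) (n : nat) (x : 'I_n -> X).

Definition sample_radius : R :=
  inf [set r | 0 <= r /\
    forall i j : 'I_n, j = i.+1 :> nat -> ball (x i) r `&` ball (x j) r !=set0].

Section Cech.
Variable r : R.

Definition cech_simplices (S : {set 'I_n}) : Prop :=
  (0 < #|S|)%N /\ \bigcap_(i in [set` S]) ball (x i) r !=set0.

Lemma cech_simplices_sub (S S' : {set 'I_n}) :
  cech_simplices S -> S' \subset S -> (0 < #|S'|)%N -> cech_simplices S'.
Proof.
move=> [_ [y Sy]] /fintype.subsetP S'S S'0; split=> //.
by exists y => i /S'S; exact: Sy.
Qed.

Definition cech : simplicial_complex 'I_n :=
  @SimplicialComplex _ cech_simplices (fun S => @proj1 _ _) cech_simplices_sub.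

(* The cube [i, j] x [k, l]. *)
Definition dist_cubes (c : ecube) : Prop :=
  exists i j k l : 'I_n,
    [/\ lo c.1 = i%:Z /\ hi c.1 = j%:Z,
        lo c.2 = k%:Z /\ hi c.2 = l%:Z,
        (j <= k)%N & cech [set:: [:: i; j; k; l]]].

Lemma dist_cubes_face c e : dist_cubes c -> cface e c -> dist_cubes e.
Proof.
have face1 (I J : eint) (i j : 'I_n) : lo I = i%:Z -> hi I = j%:Z ->
    eint_sub J I -> exists i' j' : 'I_n,
    [/\ lo J = i'%:Z, hi J = j'%:Z, i' \in [:: i; j], j' \in [:: i; j]
      & (i <= i')%N /\ (j' <= j)%N].
  case: I J => [u b] [u' b']; rewrite /lo /hi /eint_sub /lo /hi /= => ui uj h.
  have [e1|e1] : u' = i%:Z \/ u' = j%:Z by move: h; case: b ui uj; lia.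
  - have [e2|e2] : u' + (b' : nat)%:Z = i%:Z \/ u' + (b' : nat)%:Z = j%:Z.
    + by move: h; case: b ui uj; case: b'; lia.
    + by exists i, i; rewrite !inE eqxx; split => //; lia.
    + by exists i, j; rewrite !inE !eqxx orbT; split => //; lia.
  - have e2 : u' + (b' : nat)%:Z = j%:Z by move: h; case: b ui uj; case: b'; lia.
    by exists j, j; rewrite !inE !eqxx orbT; split => //; lia.
move=> [i [j [k [l [[i1 j1] [k1 l1] jk cK]]]]] /andP[f1 f2].
have [i' [j' [i'1 j'1 i'm j'm [_ j'j]]]] := face1 _ _ _ _ i1 j1 f1.
have [k' [l' [k'1 l'1 k'm l'm [kk' _]]]] := face1 _ _ _ _ k1 l1 f2.
exists i', j', k', l'; split=> //; first lia.
apply: sub_simplex cK _ _ => // v; move: i'm j'm k'm l'm; rewrite !inE.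
by do 4 case/orP=> /eqP->; case/or4P=> /eqP->; rewrite eqxx ?orbT.
Qed.

Definition dist_complex : cubical_complex := CubicalComplex dist_cubes_face.

End Cech.

Lemma cech_mono r s : r <= s -> simplices (cech r) `<=` simplices (cech s).
Proof.
move=> rs S [S0 [y Sy]]; split=> //; exists y => i Si.
exact: le_ball rs _ (Sy i Si).
Qed.

Lemma dist_complex_mono r s :
  r <= s -> cubes (dist_complex r) `<=` cubes (dist_complex s).
Proof.
move=> rs c [i [j [k [l [ij kl jk cK]]]]]; exists i, j, k, l; split=> //.
exact: cech_mono cK.
Qed.

Variable A : pzRingType.

Definition dist_chains r : chain_complex A := cub_complex A (dist_complex r).
Definition cech_chains r : chain_complex A := simp_complex A (cech r).

Definition dist_incl r s (rs : r <= s) : chain_map (dist_chains r) (dist_chains s) :=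
  cub_incl A (dist_complex_mono rs).
Definition cech_incl r s (rs : r <= s) : chain_map (cech_chains r) (cech_chains s) :=
  simp_incl A (cech_mono rs).

Section Filtrations.
Variable I : set R.

Lemma dist_incl_id (t : I) (tt : val t <= val t) k c : dist_incl tt k c = c.
Proof.
suff : dist_incl tt k =1 idfun by apply.
apply: freeMod_ext => o /=; have /andP[/asboolP Ko _] := valP o.
by rewrite -cgenE cub_incl_gen.
Qed.

Lemma dist_incl_comp (s t u : I) (st : val s <= val t) (tu : val t <= val u)
  (su : val s <= val u) k c : dist_incl tu k (dist_incl st k c) = dist_incl su k c.
Proof.
suff : dist_incl tu k \o dist_incl st k =1 dist_incl su k by apply.
apply: freeMod_ext => o /=; have /andP[/asboolP Ko _] := valP o.
by rewrite -cgenE !cub_incl_gen //; exact: dist_complex_mono Ko.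
Qed.

Definition dist_filtration : filtered_complex A I :=
  FilteredComplex (fc_obj := fun t : I => dist_chains (val t))
    dist_incl_id dist_incl_comp.

Lemma cech_incl_id (t : I) (tt : val t <= val t) k c : cech_incl tt k c = c.
Proof.
suff : cech_incl tt k =1 idfun by apply.
by apply: schain_ext => s Ks ss /=; rewrite simp_incl_osimplex.
Qed.

Lemma cech_incl_comp (s t u : I) (st : val s <= val t) (tu : val t <= val u)
  (su : val s <= val u) k c : cech_incl tu k (cech_incl st k c) = cech_incl su k c.
Proof.
suff : cech_incl tu k \o cech_incl st k =1 cech_incl su k by apply.
apply: schain_ext => v Kv sv /=; rewrite !simp_incl_osimplex //.
exact: cech_mono Kv.
Qed.

Definition cech_filtration : filtered_complex A I :=
  FilteredComplex (fc_obj := fun t : I => cech_chains (val t))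
    cech_incl_id cech_incl_comp.

End Filtrations.

Section DistanceToCech.
Variable r : R.

Local Notation symb s := (osimplex A (cech r) _ s).
Local Notation gen k c := (cgen A (dist_complex r) k c).

(* The sum of the [k - 1, k] for i < k <= j; as i < k, the cyclic predecessor
   ord_pred k is k - 1. *)
Definition path_chain (i j : 'I_n) : schain A (cech r) (0 + 1) :=
  \sum_(k < n | (i < k <= j)%N) symb [:: ord_pred k; k].

(* f is given on the generators of C(DC_r) by the formulas for psi_r. *)
Record psi_formulas (f : forall k, {linear dist_chains r k -> cech_chains r (k + 1)}) :
    Prop := PsiFormulas {
  psi_vertex : forall i j : 'I_n,
    dist_complex r (pt i%:Z, pt j%:Z) ->
    f 0 (gen 0 (pt i%:Z, pt j%:Z)) = path_chain i j - symb [:: i; j];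
  psi_horizontal : forall i i' j : 'I_n, i' = i.+1 :> nat ->
    dist_complex r (seg i%:Z, pt j%:Z) ->
    f 1 (gen 1 (seg i%:Z, pt j%:Z)) = symb [:: i; j; i'];
  psi_vertical : forall i j j' : 'I_n, j' = j.+1 :> nat ->
    dist_complex r (pt i%:Z, seg j%:Z) ->
    f 1 (gen 1 (pt i%:Z, seg j%:Z)) = symb [:: i; j; j'];
  psi_square : forall i i' j j' : 'I_n, i' = i.+1 :> nat -> j' = j.+1 :> nat ->
    dist_complex r (seg i%:Z, seg j%:Z) ->
    f 2 (gen 2 (seg i%:Z, seg j%:Z)) = symb [:: i; i'; j; j'] }.

(* The vertices of each symbol occurring in these formulas span a simplex of
   the Cech complex, so that no symbol is 0 by the convention in osimplex. *)
Record psi_symbols_in_cech : Prop := PsiSymbolsInCech {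
  psi_vertex_in : forall i j : 'I_n,
    dist_complex r (pt i%:Z, pt j%:Z) ->
    (forall k : 'I_n, (i < k <= j)%N -> cech r [set:: [:: ord_pred k; k]]) /\
    cech r [set:: [:: i; j]];
  psi_horizontal_in : forall i i' j : 'I_n, i' = i.+1 :> nat ->
    dist_complex r (seg i%:Z, pt j%:Z) -> cech r [set:: [:: i; j; i']];
  psi_vertical_in : forall i j j' : 'I_n, j' = j.+1 :> nat ->
    dist_complex r (pt i%:Z, seg j%:Z) -> cech r [set:: [:: i; j; j']];
  psi_square_in : forall i i' j j' : 'I_n, i' = i.+1 :> nat -> j' = j.+1 :> nat ->
    dist_complex r (seg i%:Z, seg j%:Z) -> cech r [set:: [:: i; i'; j; j']] }.

End DistanceToCech.

End PointCloud.

(* Main.v *)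
Require Import Defs.
From HB Require Import structures.
From mathcomp Require Import all_boot all_order all_algebra.
From mathcomp Require Import zify.
From mathcomp Require Import boolp classical_sets reals topology.

(** The map psi compares two ways from [x_i] to [x_j] when their balls meet:
    along the cloud, through the steps [[k-1, k]], and directly, by the edge
    [[i, j]]. A vertex [(i, j)] of the distance complex goes to the loop that
    they form, a 1-cycle because the path telescopes. Moving one coordinate by
    one step changes the loop by the boundary of a triangle, and the four
    triangles around a square of the distance complex are the faces of a
    tetrahedron, so the boundary formulas agree ([psi_cube_boundary]).

    The formulas make sense in the Cech complex for two reasons
    ([psi_symbols]). The vertices of every symbol attached to a cube are
    endpoints of that cube, which span a simplex by definition of the distance
    complex; the steps of the path span simplices because [r] exceeds the
    sample radius ([consecutive_simplex]), which uses that the radii in the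
    definition of the sample radius form a nonempty up-closed set.

    Since cubical chains are free, the formulas define a unique linear map, and
    everything is checked on generators. They are gathered in one function
    [psi_cube] on cubes, written uniformly over all simplicial complexes on the
    indices; as the formulas do not depend on [r] and inclusions send symbols
    to the same symbols, compatibility with the filtrations follows
    ([psi_formulas_incl]). *)

Set Implicit Arguments.
Unset Strict Implicit.
Unset Printing Implicit Defensive.

Import Order.TTheory GRing.Theory Num.Theory.

Local Open Scope classical_set_scope.
Local Open Scope ring_scope.

(** * The sample radius and the simplices of the Cech complex *)

Section CechSimplices.
Variables (R : realType) (X : metricType R) (n : nat) (x : 'I_n -> X).
Implicit Types (r : R) (i j k l : 'I_n).

(** Without this the infimum defining the sample radius would carry no
    information: any radius beyond every pairwise distance is admissible, and
    the sum of all the distances is a crude bound for them. *)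
Lemma sample_radius_set_nonempty :
  [set r : R | 0 <= r /\
    forall i j, j = i.+1 :> nat -> ball (x i) r `&` ball (x j) r !=set0] !=set0.
Proof.
pose D := \sum_i \sum_j mdist (x i) (x j).
have D0 : 0 <= D by do 2 (apply: sumr_ge0 => ? _); exact: mdist_ge0.
exists (1 + D) => /=; split=> [|i j _]; first by rewrite addr_ge0.
have dD : mdist (x j) (x i) < 1 + D.
  rewrite ltr_pwDl // /D (bigD1 j) //= (bigD1 i) //= -addrA lerDl addr_ge0 //.
    by apply: sumr_ge0 => ? _; exact: mdist_ge0.
  by do 2 (apply: sumr_ge0 => ? _); exact: mdist_ge0.
exists (x i); rewrite !ballEmdist /=; split=> //.
by rewrite mdistxx ltr_pwDl.
Qed.

(** Here the definition of the sample radius is used: above it, the steps of the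
    path along the cloud are edges of the Cech complex. *)
Lemma consecutive_simplex r i j : sample_radius x < r -> j = i.+1 :> nat ->
  cech x r [set:: [:: i; j]].
Proof.
move=> /(inf_lt sample_radius_set_nonempty)[s /= [_ Hs] sr] ij.
have [y [yi yj]] := Hs i j ij.
split; first by rewrite card_gt0; apply/set0Pn; exists i; rewrite !inE eqxx.
exists y => k; rewrite /= !inE => /orP[]/eqP->; exact: le_ball (ltW sr) _ _.
Qed.

(** Membership in the distance complex only asserts that some indices with
    these endpoints exist; integers being determined by their ordinals, it can
    be read off for the given ones. *)
Lemma dist_cube_simplex r (I J : eint) i j k l : dist_complex x r (I, J) ->
  lo I = i -> hi I = j -> lo J = k -> hi J = l ->
  cech x r [set:: [:: i; j; k; l]].
Proof.
move=> [i0 [j0 [k0 [l0 [/= [-> ->] [-> ->] _ cK]]]]].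
by move=> [/val_inj<-] [/val_inj<-] [/val_inj<-] [/val_inj<-].
Qed.

Lemma ord_pred_next i j : j = i.+1 :> nat -> ord_pred j = i.
Proof.
by move=> ji; apply: val_inj; rewrite /= ji addSn /= modnDr modn_small.
Qed.

(** A symbol other than a path step only repeats or permutes endpoints of the
    cube, so its vertices span a face of the simplex witnessing the cube; the
    path steps may leave that simplex and need the bound on [r]. *)
Lemma psi_symbols r : sample_radius x < r -> psi_symbols_in_cech x r.
Proof.
move=> rr; split=> [i j|i i' j ii'|i j j' jj'|i i' j j' ii' jj'] K.
- have cK := dist_cube_simplex K erefl (addr0 _) erefl (addr0 _).
  split=> [k /andP[ik kj]|].
    have lt : (k.-1 < n)%N by have := ltn_ord k; lia.
    have kE : k = (Ordinal lt).+1 :> nat by rewrite /=; lia.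
    by rewrite (ord_pred_next kE); exact: consecutive_simplex.
  by apply: sub_simplex cK _ _ => // v; rewrite !inE => /orP[]/eqP->; rewrite eqxx ?orbT.
- have e : hi (seg i) = i' by rewrite /hi /= ii'; lia.
  have cK := dist_cube_simplex K erefl e erefl (addr0 _).
  by apply: sub_simplex cK _ _ => // v; rewrite !inE => /or3P[]/eqP->; rewrite eqxx ?orbT.
- have e : hi (seg j) = j' by rewrite /hi /= jj'; lia.
  have cK := dist_cube_simplex K erefl (addr0 _) erefl e.
  by apply: sub_simplex cK _ _ => // v; rewrite !inE => /or3P[]/eqP->; rewrite eqxx ?orbT.
have e : hi (seg i) = i' by rewrite /hi /= ii'; lia.
have f : hi (seg j) = j' by rewrite /hi /= jj'; lia.
exact: dist_cube_simplex K erefl e erefl f.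
Qed.

(** Case analysis on a cube with its corners named by indices of the cloud, so
    that the defining formulas for psi apply. The inequalities say that the
    cube lies on or above the diagonal. *)
Variant dist_cube_spec : ecube -> Prop :=
| DistVertex i j of (i <= j)%N : dist_cube_spec (pt i, pt j)
| DistHorizontal i i' j of i' = i.+1 :> nat & (i' <= j)%N :
    dist_cube_spec (seg i, pt j)
| DistVertical i j j' of j' = j.+1 :> nat & (i <= j)%N :
    dist_cube_spec (pt i, seg j)
| DistSquare i i' j j' of i' = i.+1 :> nat & j' = j.+1 :> nat & (i' <= j)%N :
    dist_cube_spec (seg i, seg j).

Lemma dist_cubeP r c : dist_complex x r c -> dist_cube_spec c.
Proof.
move=> [i [j [k [l [[]]]]]]; case: c => -[u b] [v b'].
rewrite /lo /hi /= => -> ij [-> kl] jk _.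
case: b b' ij kl => -[] /= ij kl.
- by apply: (@DistSquare i j k l); lia.
- by apply: (@DistHorizontal i j k); lia.
- by apply: (@DistVertical i k l); lia.
- by apply: (@DistVertex i k); lia.
Qed.

End CechSimplices.

(** * The formulas for psi as one function on cubes *)

Section Generators.
Variables (A : pzRingType) (n : nat) (K : simplicial_complex 'I_n).
Implicit Types (m : int) (i j : 'I_n).

Definition vertex_of (z : int) : option 'I_n :=
  if z is Posz a then insub a else None.

(** Symbols on integers, because the corners of a cube are integers whereas the
    vertices of a simplex are indices of the cloud. *)
Definition vsymb m (s : seq int) : schain A K m :=
  osimplex A K m (pmap vertex_of s).

(** The path chain, over any complex and, as explained at [psi_cube], in a degree
    that is left free. *)
Definition steps m i j : schain A K m :=
  \sum_(k < n | (i < k <= j)%N) osimplex A K m [:: ord_pred k; k].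

(** The degree [m] is independent of the dimension of the cube: [osimplex]
    vanishes unless the degrees match. This spares any transport of chains
    between degrees that are equal but not convertible. *)
Definition psi_cube m (c : ecube) : schain A K m :=
  match c with
  | ((i, false), (j, false)) =>
      (if (vertex_of i, vertex_of j) is (Some i', Some j') then steps m i' j'
       else 0) - vsymb m [:: i; j]
  | ((i, true), (j, false)) => vsymb m [:: i; j; i + 1]
  | ((i, false), (j, true)) => vsymb m [:: i; j; j + 1]
  | ((i, true), (j, true)) => vsymb m [:: i; i + 1; j; j + 1]
  end.

Lemma vertex_ofE i : vertex_of i = Some i.
Proof. exact: valK. Qed.

Lemma vsymbE m (s : seq 'I_n) : vsymb m [seq Posz (i : 'I_n) | i <- s] = osimplex A K m s.
Proof. by rewrite /vsymb (map_pK vertex_ofE). Qed.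

Lemma psi_cube_vertex m i j :
  psi_cube m (pt i, pt j) = steps m i j - osimplex A K m [:: i; j].
Proof. by rewrite /psi_cube /= !valK -vsymbE. Qed.

Lemma Posz_next i i' : i' = i.+1 :> nat -> i%:Z + 1 = i'.
Proof. by lia. Qed.

Lemma psi_cube_horizontal m i i' j : i' = i.+1 :> nat ->
  psi_cube m (seg i, pt j) = osimplex A K m [:: i; j; i'].
Proof. by move=> e; rewrite -(vsymbE m [:: i; j; i']) /= (Posz_next e). Qed.

Lemma psi_cube_vertical m i j j' : j' = j.+1 :> nat ->
  psi_cube m (pt i, seg j) = osimplex A K m [:: i; j; j'].
Proof. by move=> e; rewrite -(vsymbE m [:: i; j; j']) /= (Posz_next e). Qed.

Lemma psi_cube_square m i i' j j' : i' = i.+1 :> nat -> j' = j.+1 :> nat ->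
  psi_cube m (seg i, seg j) = osimplex A K m [:: i; i'; j; j'].
Proof.
by move=> e f; rewrite -(vsymbE m [:: i; i'; j; j']) /= (Posz_next e) (Posz_next f).
Qed.

Lemma steps_nil m i : steps m i i = 0.
Proof. by rewrite /steps big1 // => k; lia. Qed.

Lemma steps_last m i j j' : j' = j.+1 :> nat -> (i <= j)%N ->
  steps m i j' = steps m i j + osimplex A K m [:: j; j'].
Proof.
move=> e ij; rewrite /steps (bigD1 j') /=; last lia.
rewrite (ord_pred_next e) addrC; congr (_ + _); apply: eq_bigl => k.
by rewrite -val_eqE /=; lia.
Qed.

Lemma steps_first m i i' j : i' = i.+1 :> nat -> (i' <= j)%N ->
  steps m i j = osimplex A K m [:: i; i'] + steps m i' j.
Proof.
move=> e ij; rewrite /steps (bigD1 i') /=; last lia.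
rewrite (ord_pred_next e); congr (_ + _); apply: eq_bigl => k.
by rewrite -val_eqE /=; lia.
Qed.

End Generators.

Arguments psi_cube : simpl never.

(** * Boundaries of low-dimensional simplices *)

Section FaceSums.
Variables (A : pzRingType) (T : eqType) (M : lmodType A).
Implicit Types f : seq T -> M.

Lemma face_sum2 f a b : face_sum f [:: a; b] = f [:: b] - f [:: a].
Proof. by rewrite !face_sum_cons face_sum_nil subr0. Qed.

Lemma face_sum3 f a b c :
  face_sum f [:: a; b; c] = f [:: b; c] - f [:: a; c] + f [:: a; b].
Proof. by rewrite !face_sum_cons face_sum_nil subr0 opprB addrA addrAC. Qed.

Lemma face_sum4 f a b c d : face_sum f [:: a; b; c; d] =
  f [:: b; c; d] - f [:: a; c; d] + f [:: a; b; d] - f [:: a; b; c].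
Proof.
by rewrite face_sum_cons face_sum3 opprD opprB addrA [f [:: a; b; d] - _]addrC addrA addrAC.
Qed.

End FaceSums.

(** In the two cancellations below, [p] is a path chain common to both ends of
    an edge. *)
Lemma horizontal_cancel (V : zmodType) (p a b c : V) :
  p - b - (a + p - c) = - b - a + c.
Proof.
by rewrite [a + p]addrC -[p + a - c]addrA opprD addrACA subrr add0r opprB addrA addrAC.
Qed.

Lemma vertical_cancel (V : zmodType) (p a b c : V) :
  p + a - b - (p - c) = a - b + c.
Proof. by rewrite -[p + a - b]addrA opprD addrACA subrr add0r opprK. Qed.

(** * Chains of a cubical complex *)

Section CubicalChains.
Variables (A : pzRingType) (K : cubical_complex) (k : int) (W : lmodType A).

Lemma cchain_ext (f g : {linear cchain A K k -> W}) :
  (forall c, K c -> (cdim c)%:Z = k -> f (cgen A K k c) = g (cgen A K k c)) ->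
  f =1 g.
Proof.
move=> fg; apply: freeMod_ext => o.
by have /andP[/asboolP Ko /eqP co] := valP o; rewrite -cgenE fg.
Qed.

(** The cubical boundary formula with the faces replaced by their values under
    [g]. *)
Definition cube_boundary (g : ecube -> W) (c : ecube) : W :=
  match c with
  | ((i, false), (j, false)) => 0
  | ((i, false), (j, true)) => g (pt i, pt (j + 1)) - g (pt i, pt j)
  | ((i, true), (j, false)) => g (pt (i + 1), pt j) - g (pt i, pt j)
  | ((i, true), (j, true)) =>
      g (pt (i + 1), seg j) - g (pt i, seg j) - g (seg i, pt (j + 1))
      + g (seg i, pt j)
  end.

Lemma linear_cbnd (f : {linear cchain A K k -> W}) (g : ecube -> W) c :
  K c -> (cdim c)%:Z = k + 1 ->
  (forall e, K e -> (cdim e)%:Z = k -> f (cgen A K k e) = g e) ->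
  f (cbnd A K k c) = cube_boundary g c.
Proof.
move=> Kc cd fg.
have fE e : cface e c -> (cdim e)%:Z = k -> f (cgen A K k e) = g e.
  by move=> /(cubes_face Kc); exact: fg.
case: c cd fE {Kc} => -[i b] [j b']; rewrite /cdim.
case: b b' => -[] /= cd fE.
- rewrite linearD !linearB /= !fE // /cface /eint_sub /lo /hi /=; lia.
- rewrite linearB /= !fE // /cface /eint_sub /lo /hi /=; lia.
- rewrite linearB /= !fE // /cface /eint_sub /lo /hi /=; lia.
- by rewrite linear0.
Qed.

End CubicalChains.

(** * The chain map equation on cubes *)

Section Boundary.
Variables (A : pzRingType) (R : realType) (X : metricType R) (n : nat).
Variables (x : 'I_n -> X) (r : R).
Hypothesis rR : sample_radius x < r.
Local Notation K := (cech x r).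
Local Notation L := (dist_complex x r).
Implicit Types (m : int) (i j : 'I_n) (c : ecube).

(** The steps telescope. The degree is a variable constrained by [m = 0] because
    the lemma is used in degree [k + 1], which is then only provably zero. *)
Lemma boundary_steps m i j : m = 0 -> (i <= j)%N ->
  sboundary A _ K m (steps A K (m + 1) i j) =
  osimplex A K m [:: j] - osimplex A K m [:: i].
Proof.
move=> m0; move e : (j - i)%N => d; elim: d j e => [|d IH] j e ij.
  have -> : j = i by apply: val_inj => /=; lia.
  by rewrite steps_nil linear0 subrr.
have lt : (j.-1 < n)%N by have := ltn_ord j; lia.
have je : j = (Ordinal lt).+1 :> nat by rewrite /=; lia.
rewrite (steps_last _ _ _ je) /=; last lia.
rewrite linearD /= IH /=; [|lia|lia].
rewrite sboundary_osimplex; [|exact: consecutive_simplex|by rewrite m0].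
by rewrite face_sum2 addrC addrA subrK.
Qed.

(** The chain map equation on a single cube. At a vertex the path and the
    direct edge have the same endpoints, so the difference is a cycle. At an
    edge the path chains of the two ends differ by one step, and this step bounds
    the triangle together with the two direct edges. At a square the four
    triangles are the faces of the tetrahedron, once the last two vertices are
    exchanged in those of the horizontal edges. *)
Lemma psi_cube_boundary m c : L c -> (cdim c)%:Z = m ->
  sboundary A _ K m (psi_cube A K (m + 1) c) = cube_boundary (psi_cube A K m) c.
Proof.
have [sV sH sE sS] := psi_symbols rR.
have swap i j : osimplex A K m [:: i; j] = - osimplex A K m [:: j; i].
  apply/eqP; rewrite -addr_eq0; apply/eqP.
  exact: (osimplex_alternating A K m).1 [::] _ [::] _ [::].
have swap3 i j k : osimplex A K m [:: i; j; k] = - osimplex A K m [:: i; k; j].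
  apply/eqP; rewrite -addr_eq0; apply/eqP.
  exact: (osimplex_alternating A K m).1 [:: i] _ [::] _ [::].
move=> Lc; move: (Lc); case/dist_cubeP: Lc.
- move=> i j ij Lc m0; have [_ s] := sV _ _ Lc.
  rewrite psi_cube_vertex linearB /= boundary_steps //.
  by rewrite sboundary_osimplex -?m0 // face_sum2 subrr.
- move=> i i' j ii' ij Lc m0; rewrite /= (Posz_next ii').
  rewrite (psi_cube_horizontal _ _ _ _ ii') !psi_cube_vertex.
  rewrite sboundary_osimplex; [|exact: sH Lc|by rewrite -m0].
  rewrite face_sum3 (steps_first _ _ _ ii') // (swap j i').
  by rewrite horizontal_cancel.
- move=> i j j' jj' ij Lc m0; rewrite /= (Posz_next jj').
  rewrite (psi_cube_vertical _ _ _ _ jj') !psi_cube_vertex.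
  rewrite sboundary_osimplex; [|exact: sE Lc|by rewrite -m0].
  rewrite face_sum3 (steps_last _ _ _ jj') //.
  by rewrite vertical_cancel.
move=> i i' j j' ii' jj' ij Lc m0; rewrite /= (Posz_next ii') (Posz_next jj').
rewrite (psi_cube_square _ _ _ ii' jj') !(psi_cube_horizontal _ _ _ _ ii').
rewrite !(psi_cube_vertical _ _ _ _ jj').
rewrite sboundary_osimplex; [|exact: sS Lc|by rewrite -m0].
by rewrite face_sum4 (swap3 i j i') (swap3 i j' i') opprK.
Qed.

End Boundary.

(** * Existence, uniqueness and naturality of psi *)

Section PsiMap.
Variables (A : pzRingType) (R : realType) (X : metricType R) (n : nat).
Variables (x : 'I_n -> X).
Implicit Types (r s : R) (k : int) (c : ecube).

(** The four formulas determine the values on all generators, in every degree;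
    uniqueness, the chain map equation and the naturality all reduce to
    statements on single cubes through this equivalence. *)
Lemma psi_formulasP r
    (f : forall k, {linear dist_chains x A r k -> cech_chains x A r (k + 1)}) :
  psi_formulas f <-> forall k c, dist_complex x r c -> (cdim c)%:Z = k ->
    f k (cgen A (dist_complex x r) k c) = psi_cube A (cech x r) (k + 1) c.
Proof.
split=> [[fV fH fE fS] k c Lc <-|fE]; last first.
  split=> [i j Lc|i i' j e Lc|i j j' e Lc|i i' j j' e e' Lc].
  - by rewrite fE // psi_cube_vertex.
  - by rewrite fE // (psi_cube_horizontal _ _ _ _ e).
  - by rewrite fE // (psi_cube_vertical _ _ _ _ e).
  - by rewrite fE // (psi_cube_square _ _ _ e e').
move: (Lc); case/dist_cubeP: Lc => [i j _|i i' j e _|i j j' e _|i i' j j' e e' _] Lc.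
- by rewrite psi_cube_vertex; exact: fV.
- by rewrite (psi_cube_horizontal _ _ _ _ e); exact: fH.
- by rewrite (psi_cube_vertical _ _ _ _ e); exact: fE.
- by rewrite (psi_cube_square _ _ _ e e'); exact: fS.
Qed.

Definition psi_map r k : dist_chains x A r k -> cech_chains x A r (k + 1) :=
  flin (fun o : kcube (dist_complex x r) k =>
    psi_cube A (cech x r) (k + 1) (val o)).
Arguments psi_map : clear implicits.
HB.instance Definition _ r k := GRing.Linear.on (psi_map r k).

Lemma psi_map_formulas r :
  psi_formulas (fun k => psi_map r k : {linear _ -> _}).
Proof.
apply/psi_formulasP => k c Lc /eqP cd; rewrite /cgen insubT.
  by apply/andP; split => //; exact/asboolP.
by move=> h; exact: flin_gen.
Qed.

Lemma psi_formulas_unique r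
    (f g : forall k, {linear dist_chains x A r k -> cech_chains x A r (k + 1)}) :
  psi_formulas f -> psi_formulas g -> forall k, f k =1 g k.
Proof.
move=> /psi_formulasP fE /psi_formulasP gE k; apply: cchain_ext => c Lc cd.
by rewrite fE ?gE.
Qed.

Lemma psi_formulas_chain_map r
    (f : forall k, {linear dist_chains x A r k -> cech_chains x A r (k + 1)}) :
  sample_radius x < r -> psi_formulas f -> is_chain_map1 f.
Proof.
move=> rR /psi_formulasP fE k z.
suff : sboundary A _ (cech x r) (k + 1) \o f (k + 1) =1
  f k \o cboundary A (dist_complex x r) k by apply.
apply: cchain_ext => c Lc cd /=.
rewrite fE // psi_cube_boundary // cboundary_gen //; apply/esym.
exact: linear_cbnd Lc cd (fE k).
Qed.

(** A symbol whose vertices span no simplex of the smaller complex is 0 there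
    but may be nonzero in the larger one; [psi_symbols] excludes this. *)
Lemma simp_incl_psi_cube r s (rs : r <= s) k c : sample_radius x < r ->
  dist_complex x r c ->
  cech_incl x A rs k (psi_cube A (cech x r) k c) = psi_cube A (cech x s) k c.
Proof.
move=> rR Lc; have [sV sH sE sS] := psi_symbols rR.
move: (Lc); case/dist_cubeP: Lc => [i j ij|i i' j e _|i j j' e _|i i' j j' e e' _] Lc.
- have [sK s2] := sV _ _ Lc; rewrite !psi_cube_vertex linearB /= linear_sum /=.
  rewrite simp_incl_osimplex //; congr (_ - _); apply: eq_bigr => l il.
  by rewrite simp_incl_osimplex //; exact: sK.
- rewrite !(psi_cube_horizontal _ _ _ _ e) /= simp_incl_osimplex //; exact: sH Lc.
- rewrite !(psi_cube_vertical _ _ _ _ e) /= simp_incl_osimplex //; exact: sE Lc.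
- rewrite !(psi_cube_square _ _ _ e e') /= simp_incl_osimplex //; exact: sS Lc.
Qed.

Lemma psi_formulas_incl r s (rs : r <= s)
    (f : forall k, {linear dist_chains x A r k -> cech_chains x A r (k + 1)})
    (g : forall k, {linear dist_chains x A s k -> cech_chains x A s (k + 1)}) :
  sample_radius x < r -> psi_formulas f -> psi_formulas g -> forall k z,
  cech_incl x A rs (k + 1) (f k z) = g k (dist_incl x A rs k z).
Proof.
move=> rR /psi_formulasP fE /psi_formulasP gE k z.
suff : cech_incl x A rs (k + 1) \o f k =1 g k \o dist_incl x A rs k by apply.
apply: cchain_ext => c Lc cd /=; rewrite fE // simp_incl_psi_cube //.
by rewrite cub_incl_gen // gE //; exact: dist_complex_mono Lc.
Qed.

End PsiMap.

Theorem theorem4p5 (A : pzRingType) (R : realType) (X : metricType R) (n : nat)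
    (x : 'I_n -> X) :
  [/\ forall r : R, sample_radius x < r ->
        psi_symbols_in_cech x r /\
        exists psi : forall k, {linear dist_chains x A r k -> cech_chains x A r (k + 1)},
          [/\ psi_formulas psi,
              (forall phi : forall k,
                 {linear dist_chains x A r k -> cech_chains x A r (k + 1)},
                 psi_formulas phi -> forall k c, phi k c = psi k c)
            & is_chain_map1 psi],
      forall (r s : R) (rs : r <= s), sample_radius x < r ->
        forall (psi_r : forall k,
                  {linear dist_chains x A r k -> cech_chains x A r (k + 1)})
               (psi_s : forall k,
                  {linear dist_chains x A s k -> cech_chains x A s (k + 1)}),
          psi_formulas psi_r -> psi_formulas psi_s ->
          forall k c,
            cech_incl x A rs (k + 1) (psi_r k c) = psi_s k (dist_incl x A rs k c)
    & exists Psi : filtered_map1 (dist_filtration x A [set t | sample_radius x < t])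
                                 (cech_filtration x A [set t | sample_radius x < t]),
        forall t, psi_formulas (Psi t)].
Proof.
pose psi r : forall k, {linear dist_chains x A r k -> cech_chains x A r (k + 1)} :=
  fun k => @psi_map A R X n x r k : {linear _ -> _}.
have psiP r : psi_formulas (psi r) by exact: psi_map_formulas.
split=> [r rR|r s rs rR f g fP gP|].
- split; first exact: psi_symbols.
  exists (psi r); split=> [//|phi phiP k c|]; first exact: psi_formulas_unique.
  exact: psi_formulas_chain_map.
- exact: psi_formulas_incl.
pose I := [set t | sample_radius x < t].
have IR (t : I) : sample_radius x < val t by have /set_mem := valP t.
pose Psi (t : I) := ChainMap1 (psi_formulas_chain_map (IR t) (psiP (val t))).
have comm (s t : I) (st : val s <= val t) k c :
    fc_incl (cech_filtration x A I) st (k + 1) (Psi s k c) =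
    Psi t k (fc_incl (dist_filtration x A I) st k c).
  exact: psi_formulas_incl.
exists (@FilteredMap1 A R I (dist_filtration x A I) (cech_filtration x A I) Psi comm).
by move=> t; exact: psiP.
Qed.
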